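(* For $\theta\in(0,\pi)$ let $\rho^{Ry}_\theta=|\psi^{Ry}_\theta\rangle\langle\psi^{Ry}_\theta|$ and $\rho^{Rx}_\theta=|\psi^{Rx}_\theta\rangle\langle\psi^{Rx}_\theta|$ with $|\psi^{Ry}_\theta\rangle=\cos\tfrac\theta2|00\rangle+\sin\tfrac\theta2|11\rangle$ and $|\psi^{Rx}_\theta\rangle=\cos\tfrac\theta2|00\rangle-i\sin\tfrac\theta2|11\rangle$. Then for all $\theta\in(0,\pi)$ (with $n=2$): $$C(\rho^{Ry}_\theta)=|\sin\theta|+|\cos\theta|-1,\qquad C(\rho^{Rx}_\theta)=\tfrac12\bigl(|\sin\theta|+|\cos\theta|-1\bigr),$$ $$\Gamma(\rho^{Ry}_\theta)=\Gamma(\rho^{Rx}_\theta)=|\sin\theta|+|\cos\theta|,$$ and hence, whenever $C>0$, $\kappa(\rho^{Ry}_\theta)=1$ and $\kappa(\rho^{Rx}_\theta)=2$.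
   Context: Let $I,X,Y,Z$ be the Pauli matrices. For $(q,p)\in\mathbb{F}_2^2$ define the single-qubit phase-point operator $A_{(q,p)}=\tfrac12\bigl(I+(-1)^pX+(-1)^{q+p}Y+(-1)^qZ\bigr)$. For $n$ qubits and $\alpha=(\alpha_1,\dots,\alpha_n)\in(\mathbb{F}_2^2)^n$ set $A_\alpha=A_{\alpha_1}\otimes\cdots\otimes A_{\alpha_n}$. The discrete Wigner function of an $n$-qubit operator $\rho$ is $W_\rho(\alpha)=2^{-n}\mathrm{Tr}(\rho A_\alpha)$, regarded as a vector in $\mathbb{R}^{4^n}$. $\mathrm{Stab}_n$ denotes the set of pure $n$-qubit stabilizer states, i.e. density operators $|\psi\rangle\langle\psi|$ with $|\psi\rangle$ the unique common $+1$ eigenvector of an abelian subgroup of the $n$-qubit Pauli group of size $2^n$ (not containing $-I$). The free Wigner polytope is $\mathcal{W}_{\mathrm{free}}=\mathrm{conv}\{W_\sigma:\sigma\in\mathrm{Stab}_n\}$, and the Wigner distance is $C(\rho)=\min_{f\in\mathcal{W}_{\mathrm{free}}}\|W_\rho-f\|_1$. The stabilizer extent (for mixed states) is $\Gamma(\rho)=\min\{\sum_i|\alpha_i|:\rho=\sum_i\alpha_i\sigma_i,\ \alpha_i\in\mathbb{R},\ \sigma_i\in\mathrm{Stab}_n\}$ (finite sums). For $C(\rho)>0$ the tightness ratio is $\kappa(\rho)=(\Gamma(\rho)-1)/C(\rho)$. *)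

(* Defs.v *)
From HB Require Import structures.
From mathcomp Require Import all_boot all_order all_algebra.
From mathcomp Require Import boolp classical_sets reals trigo.
From mathcomp Require complex mxtens.
Import complex.
Set Implicit Arguments. Unset Strict Implicit. Unset Printing Implicit Defensive.
Import Order.TTheory GRing.Theory Num.Theory.
Local Open Scope ring_scope.

Section Defs.
Variable R : realType.
Local Notation C := (complex.complex R).
Local Notation "A *t B" := (mxtens.tensmx A B) (at level 40, left associativity).

Definition iC : C := complex.Complex 0 1.
Definition rC (x : R) : C := complex.Complex x 0.

(* single-qubit Pauli matrices (computational basis |0>,|1> = indices 0,1) *)
Definition pI : 'M[C]_2 := 1%:M.
Definition pX : 'M[C]_2 := \matrix_(i < 2, j < 2) (if i != j then 1 else 0).
Definition pY : 'M[C]_2 :=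
  \matrix_(i < 2, j < 2) (if i == j then 0 else if (i : nat) == 0%N then - iC else iC).
Definition pZ : 'M[C]_2 :=
  \matrix_(i < 2, j < 2) (if i == j then (if (i : nat) == 0%N then 1 else -1) else 0).

Inductive pauli := PI | PX | PY | PZ.
Definition pauli_mx (p : pauli) : 'M[C]_2 :=
  match p with PI => pI | PX => pX | PY => pY | PZ => pZ end.

(* two-qubit operators: 'M_(2*2) = 'M_4, index of |ab> is 2a+b *)
Local Notation Mat := (matrix C (2 * 2) (2 * 2)).

Definition pauli_group2 (M : Mat) : Prop :=
  exists (k : nat) (p1 p2 : pauli), M = iC ^+ k *: (pauli_mx p1 *t pauli_mx p2).

Definition dagger m n (A : 'M[C]_(m, n)) : 'M[C]_(n, m) :=
  map_mx (fun z : C => complex.conjc z) A^T.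

Definition stabilizer_group (S : seq Mat) : Prop :=
  [/\ uniq S, size S = 4%N,
      (forall g, g \in S -> pauli_group2 g),
      (1%:M \in S) &
      (forall g h, g \in S -> h \in S -> g *m h \in S)] /\ [/\
      (forall g, g \in S -> exists2 h, h \in S & g *m h = 1%:M),
      (forall g h, g \in S -> h \in S -> g *m h = h *m g)
    & (- 1%:M \notin S)].

Definition stab_state (sigma : Mat) : Prop :=
  exists (S : seq Mat) (psi : 'cV[C]_(2 * 2)),
    [/\ stabilizer_group S,
        dagger psi *m psi = 1%:M,
        (forall g, g \in S -> g *m psi = psi),
        (forall phi : 'cV[C]_(2 * 2), (forall g, g \in S -> g *m phi = phi) ->
            exists c : C, phi = c *: psi)
      & sigma = psi *m dagger psi].

Definition sgnb (b : bool) : C := if b then -1 else 1.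
Definition A1 (qp : bool * bool) : 'M[C]_2 :=
  let: (q, p) := qp in
  (rC (2^-1)) *: (pI + sgnb p *: pX + sgnb (q (+) p) *: pY + sgnb q *: pZ).
Definition phase_point (a : (bool * bool) * (bool * bool)) : Mat :=
  A1 a.1 *t A1 a.2.

(* discrete Wigner function W_rho(alpha) = 2^-2 Tr(rho A_alpha) (a real number
   for Hermitian rho; we take its real part) *)
Definition wigner (rho : Mat) (a : (bool * bool) * (bool * bool)) : R :=
  complex.Re (\tr (rho *m phase_point a)) / 4%:R.

Definition l1dist (f g : (bool * bool) * (bool * bool) -> R) : R :=
  \sum_(a : (bool * bool) * (bool * bool)) `|f a - g a|.

Definition W_free (f : (bool * bool) * (bool * bool) -> R) : Prop :=
  exists l : seq (R * Mat),
    [/\ (forall x, x \in l -> 0 <= x.1 /\ stab_state x.2),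
        \sum_(x <- l) x.1 = 1
      & forall a, f a = \sum_(x <- l) x.1 * wigner x.2 a].

(* Wigner distance C(rho) (a minimum, expressed as the infimum) *)
Definition wigner_distance (rho : Mat) : R :=
  inf ([set d : R | exists f, W_free f /\ d = l1dist (wigner rho) f])%classic.

Definition stab_extent (rho : Mat) : R :=
  inf ([set t : R | exists l : seq (R * Mat),
        [/\ (forall x, x \in l -> stab_state x.2),
            rho = \sum_(x <- l) rC x.1 *: x.2
          & t = \sum_(x <- l) `|x.1|]])%classic.

Definition tightness (rho : Mat) : R :=
  (stab_extent rho - 1) / wigner_distance rho.

Definition ket00 : 'cV[C]_(2 * 2) := \col_(i < 2 * 2) (if (i : nat) == 0%N then 1 else 0).
Definition ket11 : 'cV[C]_(2 * 2) := \col_(i < 2 * 2) (if (i : nat) == 3%N then 1 else 0).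

Definition psiRy (theta : R) : 'cV[C]_(2 * 2) :=
  rC (cos (theta / 2)) *: ket00 + rC (sin (theta / 2)) *: ket11.
Definition psiRx (theta : R) : 'cV[C]_(2 * 2) :=
  rC (cos (theta / 2)) *: ket00 - (iC * rC (sin (theta / 2))) *: ket11.

Definition rhoRy (theta : R) : Mat := psiRy theta *m dagger (psiRy theta).
Definition rhoRx (theta : R) : Mat := psiRx theta *m dagger (psiRx theta).

End Defs.

(* Main.v *)
Require Import Defs.
From HB Require Import structures.
From mathcomp Require Import all_boot all_order all_algebra.
From mathcomp Require Import boolp classical_sets reals trigo.
From mathcomp Require Import ring lra.
From mathcomp Require complex mxtens.
Import complex.
Import Order.TTheory GRing.Theory Num.Theory.
Local Open Scope ring_scope.

(** Both families live in the code space spanned by |00> and |11>, on which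
    ZI, XX and XY act as logical Pauli operators Z, X and Y: the two states have
    logical Bloch vectors (z, x, y) = (cos, sin, 0) and (cos, 0, - sin), and the
    six vertices of the logical octahedron are stabilizer states. Decomposing
    over (for the extent), or moving to a face of (for the distance), this
    octahedron gives the upper bounds.

    The lower bounds rest on one fact: for a stabilizer state and anticommuting
    Paulis P and Q, |<P>| + |<Q>| <= 1. For the extent, the dual witness is
    [+-ZI + XX] (resp. [+-ZI - XY]). For the distance, it is a function with
    values in [-1, 1] on phase space whose pairing with the Wigner function is
    [(+-(ZI + IZ) + XX - YY) / 2] (resp. [(+-(ZI + IZ) - XY - YX) / 4]). *)

Section WignerExtent.
Variable R : realType.
Local Notation C := (complex.complex R).
Local Notation Mat := (matrix C (2 * 2) (2 * 2)).

(** * Pauli matrices and stabilizer states *)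

Definition pauli2 (p q : pauli) : Mat :=
  mxtens.tensmx (pauli_mx R p) (pauli_mx R q).

Definition pauli_anticomm (p q : pauli) : bool :=
  match p, q with
  | PI, _ | _, PI | PX, PX | PY, PY | PZ, PZ => false
  | _, _ => true
  end.

(** The case split produces the literals 0 and 1, on which matrix entries reduce by computation. *)
Lemma ord2P (P : 'I_2 -> Prop) : P 0 -> P 1 -> forall i, P i.
Proof.
by move=> P0 P1 [[|[|//]] h]; [move: P0|move: P1]; congr P; apply/val_inj.
Qed.

Lemma eq_complexP (x y : C) :
  complex.Re x = complex.Re y -> complex.Im x = complex.Im y -> x = y.
Proof. by case: x => a b; case: y => c d /= -> ->. Qed.

Lemma sqr_iC : iC R * iC R = -1.
Proof. by apply: eq_complexP => /=; ring. Qed.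

Ltac pauli_entries :=
  apply/matrixP; do 2 apply: ord2P;
  rewrite !mxE ?big_ord_recl ?big_ord0 ?mxE /= ?mulNr ?mulrN ?sqr_iC.

Lemma pauli_mx_sqr p : pauli_mx R p *m pauli_mx R p = 1%:M.
Proof. by case: p; rewrite /= ?mulmx1 //; pauli_entries; ring. Qed.

Lemma pauli_mx_comm p q :
  pauli_mx R p *m pauli_mx R q =
  (-1) ^+ pauli_anticomm p q *: (pauli_mx R q *m pauli_mx R p).
Proof.
case: p; case: q; rewrite /= ?expr0 ?expr1 ?scale1r ?mul1mx ?mulmx1 //;
  pauli_entries; ring.
Qed.

Lemma dagger_pauli p : dagger (pauli_mx R p) = pauli_mx R p.
Proof.
by case: p; pauli_entries; apply: eq_complexP => /=; rewrite ?oppr0 ?opprK.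
Qed.

Lemma daggerM m n k (A : 'M[C]_(m, n)) (B : 'M[C]_(n, k)) :
  dagger (A *m B) = dagger B *m dagger A.
Proof. by rewrite /dagger trmx_mul map_mxM. Qed.

Lemma daggerZ m n (c : C) (A : 'M[C]_(m, n)) :
  dagger (c *: A) = complex.conjc c *: dagger A.
Proof. by rewrite /dagger linearZ /= map_mxZ. Qed.

Lemma daggerK m n (A : 'M[C]_(m, n)) : dagger (dagger A) = A.
Proof. by apply/matrixP => i j; rewrite !mxE complex.conjcK. Qed.

Lemma dagger_pauli2 p q : dagger (pauli2 p q) = pauli2 p q.
Proof.
rewrite /dagger /pauli2 mxtens.trmx_tens mxtens.map_mxT.
by congr (mxtens.tensmx _ _); apply: dagger_pauli.
Qed.

Lemma tens1mx1 : mxtens.tensmx (1%:M : 'M[C]_2) (1%:M : 'M[C]_2) = 1%:M.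
Proof.
apply/matrixP => i j.
case: (mxtens.mxtens_indexP i) => i0 i1; case: (mxtens.mxtens_indexP j) => j0 j1.
rewrite mxtens.tensmxE !mxE (can_eq (@mxtens.mxtens_indexK 2 2)) xpair_eqE.
by rewrite -natrM mulnb.
Qed.

Lemma tensZl (a : C) (A B : 'M[C]_2) :
  mxtens.tensmx (a *: A) B = a *: mxtens.tensmx A B.
Proof. by apply/matrixP => i j; rewrite !mxE mulrA. Qed.

Lemma tensZr (a : C) (A B : 'M[C]_2) :
  mxtens.tensmx A (a *: B) = a *: mxtens.tensmx A B.
Proof. by apply/matrixP => i j; rewrite !mxE mulrCA. Qed.

Lemma tensDl (A A' B : 'M[C]_2) :
  mxtens.tensmx (A + A') B = mxtens.tensmx A B + mxtens.tensmx A' B.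
Proof. by apply/matrixP => i j; rewrite !mxE mulrDl. Qed.

Lemma tensDr (A B B' : 'M[C]_2) :
  mxtens.tensmx A (B + B') = mxtens.tensmx A B + mxtens.tensmx A B'.
Proof. by apply/matrixP => i j; rewrite !mxE mulrDr. Qed.

Lemma pauli2_sqr p q : pauli2 p q *m pauli2 p q = 1%:M.
Proof. by rewrite /pauli2 mxtens.tensmx_mul !pauli_mx_sqr tens1mx1. Qed.

(** The signs of the two tensor factors multiply, so the pair anticommutes when exactly one factor
    does. *)
Lemma pauli2_comm p q p' q' :
  pauli2 p q *m pauli2 p' q' =
  (-1) ^+ (pauli_anticomm p p' (+) pauli_anticomm q q')
    *: (pauli2 p' q' *m pauli2 p q).
Proof.
rewrite /pauli2 !mxtens.tensmx_mul pauli_mx_comm (pauli_mx_comm q).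
by rewrite tensZl tensZr scalerA signr_addb.
Qed.

Lemma norm_iCX k : complex.conjc (iC R ^+ k) * iC R ^+ k = 1.
Proof.
rewrite rmorphXn /= -exprMn (_ : _ * _ = 1) ?expr1n //.
by apply: eq_complexP => /=; ring.
Qed.

(** The phase [i ^ k] can spoil Hermiticity but not unitarity, and unitarity is enough to carry
    [g psi = psi] over to [dagger psi]. *)
Lemma unitary_pauli_group2 (g : Mat) : pauli_group2 g -> dagger g *m g = 1%:M.
Proof.
move=> [k [p [q ->]]]; rewrite -/(pauli2 p q) daggerZ dagger_pauli2.
by rewrite -scalemxAl -scalemxAr pauli2_sqr scalerA norm_iCX scale1r.
Qed.

Definition pauli_coef (rho : Mat) (p q : pauli) : R :=
  complex.Re (\tr (rho *m pauli2 p q)).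

Lemma tr_pure (psi : 'cV[C]_(2 * 2)) (M : Mat) :
  \tr (psi *m dagger psi *m M) = (dagger psi *m M *m psi) 0 0.
Proof. by rewrite -mulmxA mxtrace_mulC /mxtrace big_ord1. Qed.

(* If P commutes with the stabilizer group, uniqueness of the stabilized vector
   makes it an eigenvector of P; otherwise some stabilizer g anticommutes
   with P and <P> = <P g> = - <g P> = - <P>. *)
Lemma stab_state_pauli (sigma : Mat) : stab_state sigma ->
  exists psi : 'cV[C]_(2 * 2), [/\ psi != 0, dagger psi *m psi = 1%:M,
    sigma = psi *m dagger psi &
    forall p q, pauli_coef sigma p q = 0 \/
      exists2 c : C, c ^+ 2 = 1 & pauli2 p q *m psi = c *: psi].
Proof.
move=> [S [psi [[[_ _ Sp _ _] _] psi1 Spsi uniq_psi ->]]].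
have psi0 : psi != 0.
  apply/eqP => E; move: psi1; rewrite E mulmx0 => /matrixP/(_ 0 0).
  by rewrite !mxE /= => /esym/eqP; rewrite oner_eq0.
exists psi; split => // p q.
have [comm|] := pselect (forall g, g \in S -> g *m pauli2 p q = pauli2 p q *m g).
  right; have [g Sg|c Ec] := uniq_psi (pauli2 p q *m psi).
    by rewrite mulmxA comm // -mulmxA Spsi.
  exists c => //.
  have : (c ^+ 2) *: psi = 1 *: psi.
    rewrite scale1r expr2 -scalerA -Ec scalemxAr -Ec mulmxA pauli2_sqr.
    by rewrite mul1mx.
  move=> /eqP; rewrite -subr_eq0 -scalerBl scaler_eq0 (negbTE psi0) orbF.
  by rewrite subr_eq0 => /eqP.
move=> /existsNP[g /not_implyP[Sg gP]]; left.
have anti : pauli2 p q *m g = - (g *m pauli2 p q).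
  have [k [p' [q' Eg]]] := Sp g Sg; move: gP; rewrite Eg -/(pauli2 p' q').
  rewrite -scalemxAl -scalemxAr (pauli2_comm p q).
  by case: (_ (+) _) => [_|[]]; rewrite ?scale1r // scaleN1r scalerN.
have gd : dagger psi *m g = dagger psi.
  have : dagger g *m psi = psi.
    by rewrite -{1}(Spsi g Sg) mulmxA unitary_pauli_group2 ?mul1mx //; apply: Sp.
  by move=> /(congr1 (@dagger R _ _)); rewrite daggerM daggerK.
rewrite /pauli_coef tr_pure.
have : dagger psi *m pauli2 p q *m psi = - (dagger psi *m pauli2 p q *m psi).
  rewrite -{2}(Spsi g Sg) mulmxA -(mulmxA (dagger psi)) anti.
  by rewrite mulmxN mulNmx !mulmxA gd.
move=> /matrixP/(_ 0 0); rewrite [RHS]mxE.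
by case: (_ 0 0) => a b [] /= Ea _; lra.
Qed.

Lemma pauli_coef_eigen (psi : 'cV[C]_(2 * 2)) p q (c : C) :
  dagger psi *m psi = 1%:M -> c ^+ 2 = 1 -> pauli2 p q *m psi = c *: psi ->
  `|pauli_coef (psi *m dagger psi) p q| <= 1.
Proof.
move=> psi1 /eqP + Ec; rewrite /pauli_coef tr_pure -mulmxA Ec -scalemxAr psi1.
rewrite !mxE mulr1n mulr1 sqrf_eq1 => /orP[] /eqP -> /=.
- by rewrite normr1.
- by rewrite normrN1.
Qed.

(** The two expectations cannot both be nonzero: [psi] would be a common eigenvector with
    eigenvalues [c] and [d] equal to 1 or -1, and anticommutation would give [2 c d psi = 0]. The
    surviving expectation is such an eigenvalue. *)
Lemma stab_state_anticomm (sigma : Mat) p q p' q' :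
  stab_state sigma -> pauli_anticomm p p' (+) pauli_anticomm q q' ->
  `|pauli_coef sigma p q| + `|pauli_coef sigma p' q'| <= 1.
Proof.
move=> /stab_state_pauli[psi [psi0 psi1 -> H]] anti.
have [->|[c c1 Ec]] := H p q; have [E|[d d1 Ed]] := H p' q'.
- by rewrite E normr0 addr0 ler01.
- by rewrite normr0 add0r; apply: pauli_coef_eigen d1 Ed.
- by rewrite E normr0 addr0; apply: pauli_coef_eigen c1 Ec.
have := congr1 (mulmx^~ psi) (pauli2_comm p q p' q'); rewrite /= anti expr1.
rewrite scaleN1r mulNmx -!mulmxA Ec Ed -!scalemxAr Ec Ed !scalerA (mulrC c) => /eqP.
rewrite -subr_eq0 opprK -mulr2n -scaler_nat scalerA scaler_eq0 (negbTE psi0) orbF.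
have c0 : c != 0 by apply: contra_eq_neq c1 => ->; rewrite expr0n eq_sym oner_eq0.
have d0 : d != 0 by apply: contra_eq_neq d1 => ->; rewrite expr0n eq_sym oner_eq0.
by rewrite !mulf_eq0 pnatr_eq0 (negbTE c0) (negbTE d0).
Qed.

(** * Wigner functions in Pauli coordinates *)

(** The sign of the Pauli matrix in the phase-point operator at [a]. As functions of [a], these are
    the four characters of $\mathbb{F}_2^2$, the one of Y being the product of those of X and Z. *)
Definition pauli_sgn (p : pauli) (a : bool * bool) : R :=
  match p with
  | PI => 1
  | PX => (-1) ^+ a.2
  | PY => (-1) ^+ (a.1 (+) a.2)
  | PZ => (-1) ^+ a.1
  end.

Definition paulis := [:: PI; PX; PY; PZ].

Lemma ReD (x y : C) : complex.Re (x + y) = complex.Re x + complex.Re y.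
Proof. by case: x => a b; case: y. Qed.

Lemma Re_rCM (x : R) (z : C) : complex.Re (rC x * z) = x * complex.Re z.
Proof. by case: z => a b /=; rewrite mul0r subr0. Qed.

Lemma A1E a : A1 R a = \sum_(p <- paulis) rC (2^-1 * pauli_sgn p a) *: pauli_mx R p.
Proof.
have rCM (x y : R) : rC (x * y) = rC x * rC y :> C.
  by apply: eq_complexP => /=; ring.
have sgnbE b : sgnb R b = rC ((-1) ^+ b).
  by case: b; apply: eq_complexP; rewrite /= ?expr1 ?oppr0.
case: a => q p; rewrite /A1 !big_cons big_nil !sgnbE addr0 /= !rCM -!scalerA.
by rewrite scale1r !scalerDr -2!addrA.
Qed.

(** The 16 collects a factor 2 from each single-qubit phase-point operator and the normalisation 4
    of the Wigner function. *)
Lemma wignerE (rho : Mat) a :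
  wigner rho a = \sum_(p <- paulis) \sum_(q <- paulis)
    pauli_sgn p a.1 * pauli_sgn q a.2 * pauli_coef rho p q / 16.
Proof.
have T0 : complex.Re (\tr (rho *m 0)) = 0 by rewrite mulmx0 mxtrace0.
have TD (M N : Mat) : complex.Re (\tr (rho *m (M + N))) =
    complex.Re (\tr (rho *m M)) + complex.Re (\tr (rho *m N)).
  by rewrite mulmxDr mxtraceD ReD.
rewrite /wigner /phase_point !A1E.
rewrite (big_morph (fun A => mxtens.tensmx A _) (fun A B => tensDl A B _)
  (mxtens.tens0mx _)) (big_morph _ TD T0) mulr_suml; apply: eq_bigr => p _.
rewrite (big_morph _ (tensDr _) (mxtens.tensmx0 _)) (big_morph _ TD T0) mulr_suml.
apply: eq_bigr => q _.
rewrite tensZl tensZr scalerA -scalemxAr mxtraceZ -/(pauli2 p q) -mulrA !Re_rCM.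
by rewrite -/(pauli_coef rho p q); field.
Qed.

Lemma big_bool4 (F : (bool * bool) * (bool * bool) -> R) :
  \sum_a F a = \sum_(q1 : bool) \sum_(p1 : bool) \sum_(q2 : bool) \sum_(p2 : bool)
    F ((q1, p1), (q2, p2)).
Proof.
under [RHS]eq_bigr => q1 _ do under eq_bigr => p1 _ do
  rewrite (pair_bigA _ (fun q2 p2 => F (q1, p1, (q2, p2)))).
rewrite (pair_bigA _ (fun q1 p1 => \sum_b F (q1, p1, (b.1, b.2)))).
rewrite (pair_bigA _ (fun a b : bool * bool => F (a.1, a.2, (b.1, b.2)))).
by apply: eq_bigr => -[[? ?] [? ?]] _.
Qed.

(** * Dual witnesses and weak duality *)

(** The product [x1 * x2 * z1 * z2] is the character of YY, so expanding gives the characters of ZI,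
    IZ, XX and YY. *)
Definition witness_Ry (e : R) (a : (bool * bool) * (bool * bool)) : R :=
  let z1 := pauli_sgn PZ a.1 in let z2 := pauli_sgn PZ a.2 in
  let x1 := pauli_sgn PX a.1 in let x2 := pauli_sgn PX a.2 in
  (e * (z1 + z2) + x1 * x2 * (1 - z1 * z2)) / 2.

(** Here [z1 * x1 * x2] is the character of YX and [z2 * x1 * x2] that of XY. *)
Definition witness_Rx (e : R) (a : (bool * bool) * (bool * bool)) : R :=
  let z1 := pauli_sgn PZ a.1 in let z2 := pauli_sgn PZ a.2 in
  let x1 := pauli_sgn PX a.1 in let x2 := pauli_sgn PX a.2 in
  (z1 + z2) * (e - x1 * x2) / 4.

(** The two terms have disjoint supports: the value is [e * z1] where the Z signs agree and
    [x1 * x2] where they differ. *)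
Lemma witness_Ry_le1 e a : `|e| <= 1 -> `|witness_Ry e a| <= 1.
Proof.
rewrite /witness_Ry !ler_norml => /andP[? ?].
by case: a => [[[] []] [[] []]] /=; lra.
Qed.

(** The value is 0 where the Z signs differ, and [z1 * (e - x1 * x2) / 2] where they agree. *)
Lemma witness_Rx_le1 e a : `|e| <= 1 -> `|witness_Rx e a| <= 1.
Proof.
rewrite /witness_Rx !ler_norml => /andP[? ?].
by case: a => [[[] []] [[] []]] /=; lra.
Qed.

Lemma sum_wignerE (v : (bool * bool) * (bool * bool) -> R) (rho : Mat) :
  \sum_a v a * wigner rho a = \sum_(p <- paulis) \sum_(q <- paulis)
    (\sum_a v a * (pauli_sgn p a.1 * pauli_sgn q a.2)) * pauli_coef rho p q / 16.
Proof.
under eq_bigr do rewrite wignerE mulr_sumr.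
rewrite exchange_big; apply: eq_bigr => p _.
under eq_bigr do rewrite mulr_sumr.
rewrite exchange_big; apply: eq_bigr => q _ /=.
by rewrite -mulrA mulr_suml; apply: eq_bigr => a _; rewrite !mulrA.
Qed.

Lemma witness_RyE e (rho : Mat) : \sum_a witness_Ry e a * wigner rho a =
  (e * (pauli_coef rho PZ PI + pauli_coef rho PI PZ)
    + pauli_coef rho PX PX - pauli_coef rho PY PY) / 2.
Proof.
(* Orthogonality of characters leaves the coefficient of the witness times the 16 phase points; here
   8 = 16 / 2. *)
have charE p q : \sum_a witness_Ry e a * (pauli_sgn p a.1 * pauli_sgn q a.2) =
    8 * match p, q with
        PZ, PI | PI, PZ => e | PX, PX => 1 | PY, PY => -1 | _, _ => 0 end.
  by rewrite big_bool4 !big_bool; case: p; case: q; rewrite /witness_Ry /=; field.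
rewrite sum_wignerE; move: (pauli_coef rho) => r.
by rewrite !big_cons !big_nil !charE /=; field.
Qed.

Lemma witness_RxE e (rho : Mat) : \sum_a witness_Rx e a * wigner rho a =
  (e * (pauli_coef rho PZ PI + pauli_coef rho PI PZ)
    - pauli_coef rho PX PY - pauli_coef rho PY PX) / 4.
Proof.
have charE p q : \sum_a witness_Rx e a * (pauli_sgn p a.1 * pauli_sgn q a.2) =
    4 * match p, q with
        PZ, PI | PI, PZ => e | PX, PY | PY, PX => -1 | _, _ => 0 end.
  by rewrite big_bool4 !big_bool; case: p; case: q; rewrite /witness_Rx /=; field.
rewrite sum_wignerE; move: (pauli_coef rho) => r.
by rewrite !big_cons !big_nil !charE /=; field.
Qed.

(** Weak duality between the l1 and sup norms: the bound [K] at the vertices passes to their convex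
    hull, and pairing with [v] never exceeds the l1 norm. *)
Lemma l1dist_ge (v : (bool * bool) * (bool * bool) -> R) (K : R) (rho : Mat) f :
  (forall a, `|v a| <= 1) ->
  (forall sigma, stab_state sigma -> \sum_a v a * wigner sigma a <= K) ->
  W_free f -> \sum_a v a * wigner rho a - K <= l1dist (wigner rho) f.
Proof.
move=> v1 vK [l [lP l1 fE]].
have -> : K = \sum_(x <- l) x.1 * K by rewrite -mulr_suml l1 mul1r.
have vf : \sum_a v a * f a <= \sum_(x <- l) x.1 * K.
  under eq_bigr => a _ do rewrite fE mulr_sumr.
  rewrite exchange_big /= !big_seq; apply: ler_sum => x /lP[x0 /vK xK].
  under eq_bigr => a _ do rewrite mulrCA.
  by rewrite -mulr_sumr ler_wpM2l.
apply: le_trans (lerB (lexx _) vf) _; rewrite -sumrB; apply: ler_sum => a _.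
rewrite -mulrBr (le_trans (ler_norm _)) // normrM.
by rewrite ler_piMl.
Qed.

(** The left side is linear in the operator and has absolute value at most 1 on every stabilizer
    state, so each term of the decomposition contributes at most the modulus of its weight. *)
Lemma stab_extent_ge (e e' : R) p q p' q' (rho : Mat) (l : seq (R * Mat)) :
  `|e| <= 1 -> `|e'| <= 1 -> pauli_anticomm p p' (+) pauli_anticomm q q' ->
  (forall x, x \in l -> stab_state x.2) -> rho = \sum_(x <- l) rC x.1 *: x.2 ->
  e * pauli_coef rho p q + e' * pauli_coef rho p' q' <= \sum_(x <- l) `|x.1|.
Proof.
move=> e1 e'1 anti lP ->.
have coefE p1 q1 : pauli_coef (\sum_(x <- l) rC x.1 *: x.2) p1 q1 =
    \sum_(x <- l) x.1 * pauli_coef x.2 p1 q1.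
  have coef0 : pauli_coef 0 p1 q1 = 0 by rewrite /pauli_coef mul0mx mxtrace0.
  have coefD M N : pauli_coef (M + N) p1 q1 = pauli_coef M p1 q1 + pauli_coef N p1 q1.
    by rewrite /pauli_coef mulmxDl mxtraceD ReD.
  rewrite (big_morph (fun M => pauli_coef M p1 q1) coefD coef0).
  by apply: eq_bigr => x _; rewrite /pauli_coef -scalemxAl mxtraceZ Re_rCM.
rewrite !coefE !mulr_sumr -big_split /= !big_seq; apply: ler_sum => x /lP xs.
rewrite !(mulrCA _ x.1) -mulrDr (le_trans (ler_norm _)) // normrM ler_piMr //.
have := stab_state_anticomm _ _ _ _ _ xs anti; apply: le_trans.
by rewrite (le_trans (ler_normD _ _)) // lerD // normrM ler_piMl.
Qed.

(** The explicit optimum supplies nonemptiness and the dual bound supplies boundedness, so [inf] is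
    a genuine minimum and not a default value. *)
Lemma inf_min (E : set R) m : E m -> lbound E m -> inf E = m.
Proof.
move=> Em mE; apply/le_anti/andP; split; first by apply: ge_inf => //; exists m.
by apply: lb_le_inf => //; exists m.
Qed.

(** * The code space *)

Local Notation idx i k := (mxtens.mxtens_index (i : 'I_2, k : 'I_2)).

Definition codev (u v : C) : 'cV[C]_(2 * 2) := u *: ket00 R + v *: ket11 R.

Lemma ket00E : ket00 R = delta_mx (idx 0 0) 0.
Proof.
apply/matrixP => i j; rewrite !mxE (ord1 j) andbT.
by have -> : (i == idx 0 0) = (val i == 0%N) by []; case: ifP.
Qed.

Lemma ket11E : ket11 R = delta_mx (idx 1 1) 0.
Proof.
apply/matrixP => i j; rewrite !mxE (ord1 j) andbT.
by have -> : (i == idx 1 1) = (val i == 3%N) by []; case: ifP.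
Qed.

Lemma codevE u v i k : codev u v (idx i k) 0 =
  if i == k then (if i == 0 then u else v) else 0.
Proof.
rewrite /codev ket00E ket11E !mxE !(can_eq (@mxtens.mxtens_indexK 2 2)) !xpair_eqE.
by move: i k; do 2 apply: ord2P; rewrite /= ?mulr0 ?mulr1 ?addr0 ?add0r.
Qed.

Lemma pauli2_codevE p q u v i k : (pauli2 p q *m codev u v) (idx i k) 0 =
  u * (pauli_mx R p i 0 * pauli_mx R q k 0) + v * (pauli_mx R p i 1 * pauli_mx R q k 1).
Proof.
rewrite mulmxDr -!scalemxAr ket00E ket11E -!colE /pauli2.
by rewrite !mxE !mxtens.mxtens_indexK.
Qed.

Lemma codev_ext (phi : 'cV[C]_(2 * 2)) u v :
  (forall i k, phi (idx i k) 0 = if i == k then (if i == 0 then u else v) else 0) ->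
  phi = codev u v.
Proof.
move=> E; apply/matrixP => i j; rewrite (ord1 j).
by case: (mxtens.mxtens_indexP i) => i0 i1; rewrite E codevE.
Qed.

(** ZZ is diagonal with entry -1 at |01> and |10>, so these coordinates of a fixed vector equal
    their own negatives. *)
Lemma fixed_ZZ (phi : 'cV[C]_(2 * 2)) : pauli2 PZ PZ *m phi = phi ->
  phi = codev (phi (idx 0 0) 0) (phi (idx 1 1) 0).
Proof.
move=> fix_phi.
have E i k : phi (idx i k) 0 = pZ R i i * pZ R k k * phi (idx i k) 0.
  rewrite -{1}fix_phi mxE (bigD1 (idx i k)) //= mxtens.tensmxE big1 ?addr0 // => j.
  case: (mxtens.mxtens_indexP j) => j0 j1.
  rewrite (can_eq (@mxtens.mxtens_indexK 2 2)) xpair_eqE negb_and mxtens.tensmxE !mxE.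
  by case: (altP (i =P j0)) => [->|]; case: (altP (k =P j1)) => [->|];
    rewrite ?eqxx ?mulr0 ?mul0r.
have zero (x : C) : x = - x -> x = 0.
  by move=> /eqP; rewrite -addr_eq0 -mulr2n mulrn_eq0 => /eqP.
apply: codev_ext; do 2 apply: ord2P => //=; apply: zero; rewrite {1}E !mxE /=; ring.
Qed.

(** * Stabilizer groups from two generators *)

(** The number is an exponent of [i], with 3 standing for the phase [-i]. *)
Definition pauli_mul (p q : pauli) : nat * pauli :=
  match p, q with
  | PI, r | r, PI => (0%N, r)
  | PX, PX | PY, PY | PZ, PZ => (0%N, PI)
  | PX, PY => (1%N, PZ) | PY, PZ => (1%N, PX) | PZ, PX => (1%N, PY)
  | PY, PX => (3%N, PZ) | PZ, PY => (3%N, PX) | PX, PZ => (3%N, PY)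
  end.

Lemma pauli_mx_mul p q : pauli_mx R p *m pauli_mx R q =
  iC R ^+ (pauli_mul p q).1 *: pauli_mx R (pauli_mul p q).2.
Proof.
case: p; case: q; rewrite /= ?expr0 ?scale1r ?mul1mx ?mulmx1 //;
  pauli_entries; rewrite ?expr1 ?exprS ?expr0 ?mulr1 ?sqr_iC; ring: sqr_iC.
Qed.

Lemma pauli_group2_mul (g h : Mat) :
  pauli_group2 g -> pauli_group2 h -> pauli_group2 (g *m h).
Proof.
move=> [k [p [q ->]]] [k' [p' [q' ->]]].
exists (k + k' + (pauli_mul p p').1 + (pauli_mul q q').1)%N.
exists (pauli_mul p p').2, (pauli_mul q q').2.
rewrite -scalemxAl -scalemxAr mxtens.tensmx_mul !pauli_mx_mul tensZl tensZr !scalerA.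
by rewrite !exprD !mulrA.
Qed.

(** Two distinct commuting involutions other than 1 generate a group of four elements, [1], [g], [h]
    and [g h]. It cannot contain -1, which would have to fix the unit vector [psi]. *)
Lemma stab_state_gen (g h : Mat) (psi : 'cV[C]_(2 * 2)) :
  pauli_group2 g -> pauli_group2 h -> g *m g = 1%:M -> h *m h = 1%:M ->
  g *m h = h *m g -> g != 1%:M -> h != 1%:M -> g != h ->
  dagger psi *m psi = 1%:M -> g *m psi = psi -> h *m psi = psi ->
  (forall phi : 'cV[C]_(2 * 2), g *m phi = phi -> h *m phi = phi ->
    exists c : C, phi = c *: psi) ->
  stab_state (psi *m dagger psi).
Proof.
move=> Pg Ph gg hh gh g1 h1 neq_gh psi1 gpsi hpsi uniq_psi.
have ggh : g *m (g *m h) = h by rewrite mulmxA gg mul1mx.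
have ghh : g *m h *m h = g by rewrite -mulmxA hh mulmx1.
have hgh : h *m (g *m h) = g by rewrite gh mulmxA hh mul1mx.
have ghg : g *m h *m g = h by rewrite gh -mulmxA gg mulmx1.
have ghgh : g *m h *m (g *m h) = 1%:M by rewrite mulmxA ghg hh.
pose S := [:: 1%:M; g; h; g *m h].
have inS x : x \in S -> [\/ x = 1%:M, x = g, x = h | x = g *m h].
  by rewrite !inE => /or4P[] /eqP ->; [apply: Or41|apply: Or42|apply: Or43|apply: Or44].
have S1 : 1%:M \in S by rewrite inE eqxx.
have Sg : g \in S by rewrite !inE eqxx !orbT.
have Sh : h \in S by rewrite !inE eqxx !orbT.
have Sgh : g *m h \in S by rewrite !inE eqxx !orbT.
have Spsi x : x \in S -> x *m psi = psi.
  by move=> /inS[] ->; rewrite ?mul1mx // -mulmxA hpsi.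
exists S, psi; split => //; last first.
  by move=> phi fix_phi; apply: uniq_psi; apply: fix_phi.
split; split => //.
- rewrite /= !inE !negb_or !(eq_sym 1%:M) g1 h1 neq_gh /= !andbT.
  apply/and3P; split; apply/eqP => E.
  + by move: neq_gh; rewrite -ggh E mulmx1 eqxx.
  + by move: h1; rewrite -ggh -E gg eqxx.
  + by move: g1; rewrite -ghh -E hh eqxx.
- have P1 : pauli_group2 (1%:M : Mat).
    by exists 0%N, PI, PI; rewrite scale1r tens1mx1.
  by move=> x /inS[] -> //; apply: pauli_group2_mul.
- by move=> x y /inS[] -> /inS[] ->; rewrite ?mul1mx ?mulmx1 ?gg ?hh -?gh
    ?ggh ?ghh ?hgh ?ghg ?ghgh.
- move=> x /inS[] ->; [exists 1%:M|exists g|exists h|exists (g *m h)] => //.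
  exact: mulmx1.
- by move=> x y /inS[] -> /inS[] ->;
    rewrite ?mul1mx ?mulmx1 ?gg ?hh ?ggh ?ghh ?hgh ?ghg ?ghgh.
- apply/negP => /Spsi; rewrite mulNmx mul1mx => /eqP.
  rewrite eq_sym -addr_eq0 -mulr2n -scaler_nat scaler_eq0 pnatr_eq0 /= => /eqP E.
  move: psi1; rewrite E mulmx0 => /matrixP/(_ 0 0).
  by rewrite !mxE /= => /esym/eqP; rewrite oner_eq0.
Qed.

(** * Operators supported on the code space *)

Definition codemx (a b c d : C) : Mat :=
  a *: delta_mx (idx 0 0) (idx 0 0) + b *: delta_mx (idx 1 1) (idx 1 1)
  + c *: delta_mx (idx 0 0) (idx 1 1) + d *: delta_mx (idx 1 1) (idx 0 0).

Lemma dagger_codev (u v : C) : dagger (codev u v) =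
  complex.conjc u *: delta_mx 0 (idx 0 0) + complex.conjc v *: delta_mx 0 (idx 1 1).
Proof.
by rewrite /dagger /codev ket00E ket11E linearD !linearZ /= map_mxD !map_mxZ
  !trmx_delta !map_delta_mx.
Qed.

Lemma codev_pure (u v : C) : codev u v *m dagger (codev u v) =
  codemx (u * complex.conjc u) (v * complex.conjc v)
         (u * complex.conjc v) (v * complex.conjc u).
Proof.
rewrite dagger_codev /codev ket00E ket11E mulmxDr !mulmxDl -!scalemxAl -!scalemxAr.
rewrite !mul_delta_mx !scalerA /codemx -!addrA; congr (_ + _).
by rewrite addrA addrC; congr (_ + _); rewrite addrC.
Qed.

Lemma codev_norm (u v : C) : dagger (codev u v) *m codev u v =
  (complex.conjc u * u + complex.conjc v * v)%:M.
Proof.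
rewrite dagger_codev /codev ket00E ket11E mulmxDr !mulmxDl -!scalemxAl -!scalemxAr.
rewrite !mul_delta_mx_cond !scalerA (can_eq (@mxtens.mxtens_indexK 2 2)).
rewrite (can_eq (@mxtens.mxtens_indexK 2 2)) /= !mulr0n !scaler0 addr0 add0r.
by apply/matrixP => i j; rewrite !ord1 !mxE /= !mulr1 mulr1n.
Qed.

Lemma tr_codemx_pauli2 a b c d p q : \tr (codemx a b c d *m pauli2 p q) =
  a * (pauli_mx R p 0 0 * pauli_mx R q 0 0) + b * (pauli_mx R p 1 1 * pauli_mx R q 1 1)
  + c * (pauli_mx R p 1 0 * pauli_mx R q 1 0) + d * (pauli_mx R p 0 1 * pauli_mx R q 0 1).
Proof.
have trE i j (M : Mat) : \tr (delta_mx i j *m M) = M j i.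
  rewrite /mxtrace (bigD1 i) //= big1 ?addr0 => [|k /negbTE ki].
    rewrite mxE (bigD1 j) //= big1 ?addr0 => [|l /negbTE lj].
      by rewrite mxE !eqxx mul1r.
    by rewrite mxE lj andbF mul0r.
  by rewrite mxE big1 // => l _; rewrite mxE ki mul0r.
by rewrite !mulmxDl -!scalemxAl !mxtraceD !mxtraceZ !trE !mxtens.tensmxE.
Qed.

Lemma codemxZ x a b c d : x *: codemx a b c d = codemx (x * a) (x * b) (x * c) (x * d).
Proof. by rewrite /codemx !scalerDr !scalerA. Qed.

Lemma codemxD a b c d a' b' c' d' : codemx a b c d + codemx a' b' c' d' =
  codemx (a + a') (b + b') (c + c') (d + d').
Proof.
rewrite /codemx !scalerDl addrACA; congr (_ + _); rewrite addrACA.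
by congr (_ + _); rewrite addrACA.
Qed.

(** The generators are the signed Pauli and ZZ. As ZZ confines fixed vectors to the code space,
    uniqueness is only asked there. The last hypothesis separates the signed Pauli from both 1 and
    ZZ, whose diagonal entries at |00> and |11> are all 1. *)
Lemma codev_stab (b : bool) p q (u v : C) :
  ~~ (pauli_anticomm p PZ (+) pauli_anticomm q PZ) ->
  complex.conjc u * u + complex.conjc v * v = 1 ->
  (-1) ^+ b *: pauli2 p q *m codev u v = codev u v ->
  (forall u' v', (-1) ^+ b *: pauli2 p q *m codev u' v' = codev u' v' ->
    exists c, u' = c * u /\ v' = c * v) ->
  ~ ((-1) ^+ b * (pauli_mx R p 0 0 * pauli_mx R q 0 0) = 1 /\
     (-1) ^+ b * (pauli_mx R p 1 1 * pauli_mx R q 1 1) = 1) ->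
  stab_state (codemx (u * complex.conjc u) (v * complex.conjc v)
         (u * complex.conjc v) (v * complex.conjc u)).
Proof.
move=> comm norm1 fix_uv uniq_uv neq; rewrite -codev_pure.
set g := _ *: _ in fix_uv uniq_uv.
apply: (stab_state_gen g (pauli2 PZ PZ)) => //.
(* The sign [(-1) ^ b] is the phase [i ^ (2 b)]. *)
- exists (2 * b)%N, p, q; rewrite exprM (_ : iC R ^+ 2 = -1) //; exact: sqr_iC.
- by exists 0%N, PZ, PZ; rewrite scale1r.
- by rewrite -scalemxAl -scalemxAr pauli2_sqr scalerA -expr2 sqrr_sign scale1r.
- exact: pauli2_sqr.
- rewrite -scalemxAl -scalemxAr pauli2_comm.
  by rewrite (negbTE comm) scale1r.
- apply/eqP => /matrixP E; apply: neq; split.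
    by have := E (idx 0 0) (idx 0 0); rewrite !mxE !mxtens.mxtens_indexK eqxx.
  by have := E (idx 1 1) (idx 1 1); rewrite !mxE !mxtens.mxtens_indexK eqxx.
- apply/eqP => /matrixP/(_ (idx 0 1) (idx 0 1)); rewrite mxtens.tensmxE !mxE eqxx /=.
  by rewrite mul1r => /eqP; rewrite -subr_eq0 -opprD oppr_eq0 -mulr2n pnatr_eq0.
- apply/eqP => /matrixP E; apply: neq; split.
    have := E (idx 0 0) (idx 0 0); rewrite mxtens.tensmxE 2!mxE !mxtens.mxtens_indexK.
    by rewrite !mxE /= mulr1.
  have := E (idx 1 1) (idx 1 1); rewrite mxtens.tensmxE 2!mxE !mxtens.mxtens_indexK.
  by rewrite !mxE /= mulrNN mulr1.
- by rewrite codev_norm norm1.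
- apply: codev_ext => i k; rewrite pauli2_codevE.
  by move: i k; do 2 apply: ord2P; rewrite !mxE /=; ring.
- move=> phi gphi /fixed_ZZ Ephi; rewrite Ephi in gphi *.
  have [c [-> ->]] := uniq_uv _ _ gphi; exists c.
  by rewrite /codev scalerDr !scalerA.
Qed.

Lemma sign_pauli2_codevE (b : bool) p q (u v : C) i k :
  ((-1) ^+ b *: pauli2 p q *m codev u v) (idx i k) 0 = (-1) ^+ b *
  (u * (pauli_mx R p i 0 * pauli_mx R q k 0) + v * (pauli_mx R p i 1 * pauli_mx R q k 1)).
Proof. by rewrite -scalemxAl mxE pauli2_codevE. Qed.

(* The code-space operator with logical Bloch vector (z, x, y). *)
Definition codeop (z x y : R) : Mat :=
  codemx (rC ((1 + z) / 2)) (rC ((1 - z) / 2))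
         (complex.Complex (x / 2) (- (y / 2))) (complex.Complex (x / 2) (y / 2)).

Lemma eq_codemx a b c d a' b' c' d' : a = a' -> b = b' -> c = c' -> d = d' ->
  codemx a b c d = codemx a' b' c' d'.
Proof. by move=> -> -> -> ->. Qed.

(** The state is |00> or |11>, stabilized by ZI up to the sign [(-1) ^ b]. *)
Lemma stab_codeop_z (b : bool) : stab_state (codeop ((-1) ^+ b) 0 0).
Proof.
pose u : C := rC (~~ b)%:R; pose v : C := rC b%:R.
have -> : codeop ((-1) ^+ b) 0 0 =
    codemx (u * complex.conjc u) (v * complex.conjc v)
           (u * complex.conjc v) (v * complex.conjc u).
  by apply: eq_codemx; apply: eq_complexP => /=; case: b {u v} => /=;
    rewrite ?expr0 ?expr1 ?mulr1n ?mulr0n; field.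
have [rC0 rC1] : rC 0 = 0 :> C /\ rC 1 = 1 :> C by [].
have zero (x : C) : - x = x -> x = 0.
  by move=> /eqP; rewrite eq_sym -addr_eq0 -mulr2n mulrn_eq0 => /eqP.
apply: (@codev_stab b PZ PI) => //.
- by apply: eq_complexP => /=; case: b {u v} => /=; ring.
- apply: codev_ext => i k; rewrite sign_pauli2_codevE.
  by move: i k; do 2 apply: ord2P; rewrite !mxE /u /v /=; case: b {u v} => /=;
  rewrite ?expr0 ?expr1 ?mulr1n ?mulr0n ?rC0 ?rC1; ring.
- move=> u' v' /matrixP E; have := E (idx 0 0) 0; have := E (idx 1 1) 0.
  rewrite !sign_pauli2_codevE !codevE !mxE /= => {E}.
  rewrite {}/u {}/v; case: b => /=;
    rewrite ?expr0 ?expr1 !mulr1n !mulr0n rC0 rC1 => E1 E2.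
    by exists v'; split; [rewrite mulr0; apply: zero; rewrite -[RHS]E2|]; ring.
  by exists u'; split; [|rewrite mulr0; apply: zero; rewrite -[RHS]E1]; ring.
- rewrite !mxE /= => -[E1 E2]; have := congr1 (fun x => complex.Re x) E1.
  have := congr1 (fun x => complex.Re x) E2.
  by case: b {E1 E2 u v} => /=; rewrite ?expr0 ?expr1 /=; lra.
Qed.

Lemma sqr_sqrt_half : Num.sqrt (2^-1 : R) * Num.sqrt 2^-1 = 2^-1.
Proof. by rewrite -expr2 sqr_sqrtr // invr_ge0. Qed.

Lemma sqrt_half_neq0 : rC (Num.sqrt (2^-1 : R)) != 0.
Proof.
apply/eqP => -[E]; have := sqr_sqrt_half; rewrite E mul0r; lra.
Qed.

(** The Bell states with amplitudes [k] and [k] or [-k], where [k] is the square root of 1/2, are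
    stabilized by XX up to sign. *)
Lemma stab_codeop_x (b : bool) : stab_state (codeop 0 ((-1) ^+ b) 0).
Proof.
have kk := sqr_sqrt_half; have k0 := sqrt_half_neq0; move: kk k0.
set k := Num.sqrt _ => kk k0.
pose u : C := rC k; pose v : C := (-1) ^+ b * rC k.
have -> : codeop 0 ((-1) ^+ b) 0 = codemx (u * complex.conjc u) (v * complex.conjc v)
         (u * complex.conjc v) (v * complex.conjc u).
  by rewrite /u /v; case: b {v}; apply: eq_codemx; apply: eq_complexP => /=;
    rewrite ?expr0 ?expr1 /=; lra.
apply: (@codev_stab b PX PX) => //.
- by rewrite /u /v; case: b {v}; apply: eq_complexP => /=; rewrite ?expr0 ?expr1 /=; lra.
- apply: codev_ext => i j; rewrite sign_pauli2_codevE /u /v.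
  by move: i j; do 2 apply: ord2P; rewrite !mxE /=; case: b {v};
    rewrite /= ?expr0 ?expr1; ring.
(* The |11> coordinate of the fixed-point equation already determines [v'] from [u']. *)
- move=> u' v' /matrixP E; have := E (idx 1 1) 0.
  rewrite !sign_pauli2_codevE !codevE !mxE /= => {E} E.
  exists (u' / rC k); rewrite /u /v -E; split; first by rewrite mulfVK.
  by field.
- by rewrite !mxE /= !mul0r !mulr0 => -[/esym/eqP]; rewrite oner_eq0.
Qed.

(** As for the Bell states, with relative phase [i] or [-i] and XY in place of XX. *)
Lemma stab_codeop_y (b : bool) : stab_state (codeop 0 0 ((-1) ^+ b)).
Proof.
have kk := sqr_sqrt_half; have k0 := sqrt_half_neq0; move: kk k0.
set k := Num.sqrt _ => kk k0.
pose u : C := rC k; pose v : C := (-1) ^+ b * iC R * rC k.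
have -> : codeop 0 0 ((-1) ^+ b) = codemx (u * complex.conjc u) (v * complex.conjc v)
         (u * complex.conjc v) (v * complex.conjc u).
  by rewrite /u /v; case: b {v}; apply: eq_codemx; apply: eq_complexP => /=;
    rewrite ?expr0 ?expr1 /=; lra.
apply: (@codev_stab b PX PY) => //.
- by rewrite /u /v; case: b {v}; apply: eq_complexP => /=; rewrite ?expr0 ?expr1 /=; lra.
- apply: codev_ext => i j; rewrite sign_pauli2_codevE /u /v.
  move: i j; do 2 apply: ord2P; rewrite !mxE /=; case: b {v}; rewrite /= ?expr0 ?expr1;
  by ring: sqr_iC.
- move=> u' v' /matrixP E; have := E (idx 1 1) 0.
  rewrite !sign_pauli2_codevE !codevE !mxE /= => {E} E.
  exists (u' / rC k); rewrite /u /v -E; split; first by rewrite mulfVK.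
  by field.
- by rewrite !mxE /= !mul0r !mulr0 => -[/esym/eqP]; rewrite oner_eq0.
Qed.

(** * Pauli coordinates and Wigner functions of code operators *)

(** ZZ acts as the identity on the code space; multiplying by it identifies IZ with ZI, YX with XY,
    and YY with minus XX. *)
Definition code_coef (z x y : R) (p q : pauli) : R :=
  match p, q with
  | PI, PI | PZ, PZ => 1
  | PI, PZ | PZ, PI => z
  | PX, PX => x
  | PY, PY => - x
  | PX, PY | PY, PX => y
  | _, _ => 0
  end.

Lemma pauli_coef_codeop z x y p q : pauli_coef (codeop z x y) p q = code_coef z x y p q.
Proof.
rewrite /pauli_coef tr_codemx_pauli2.
by case: p; case: q; rewrite !mxE /=; field.
Qed.

(** The coordinate [x] is visible only where the Z signs differ, while [z] and [y] share the points
    where they agree. This asymmetry makes the two Wigner distances differ. *)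
Lemma wigner_codeop z x y a : wigner (codeop z x y) a =
  let z1 := pauli_sgn PZ a.1 in let z2 := pauli_sgn PZ a.2 in
  let x1 := pauli_sgn PX a.1 in let x2 := pauli_sgn PX a.2 in
  (1 + z1 * z2 + z * (z1 + z2) + x * (x1 * x2) * (1 - z1 * z2)
    + y * (x1 * x2) * (z1 + z2)) / 16.
Proof.
rewrite wignerE; under eq_bigr do under eq_bigr do rewrite pauli_coef_codeop.
rewrite !big_cons !big_nil.
by case: a => [[[] []] [[] []]] /=; field.
Qed.

Lemma cos_sin_double (theta : R) :
  cos theta = cos (theta / 2) * cos (theta / 2) - sin (theta / 2) * sin (theta / 2) /\
  sin theta = 2 * (cos (theta / 2) * sin (theta / 2)).
Proof.
have {1 6}-> : theta = theta / 2 + theta / 2 by field.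
by rewrite cosD sinD; split => //; ring.
Qed.

Lemma rhoRyE theta : rhoRy theta = codeop (cos theta) (sin theta) 0.
Proof.
rewrite /rhoRy -[psiRy theta]/(codev _ _) codev_pure.
have [-> ->] := cos_sin_double theta.
have := cos2Dsin2 (theta / 2); rewrite !expr2 => cs1.
by apply: eq_codemx; apply: eq_complexP => /=; lra.
Qed.

Lemma rhoRxE theta : rhoRx theta = codeop (cos theta) 0 (- sin theta).
Proof.
rewrite /rhoRx /psiRx -scaleNr -/(codev _ _) codev_pure.
have [-> ->] := cos_sin_double theta.
have := cos2Dsin2 (theta / 2); rewrite !expr2 => cs1.
by apply: eq_codemx; apply: eq_complexP => /=; lra.
Qed.
Lemma stab_state_anticomm_le (sigma : Mat) (b b' : bool) p q p' q' :
  stab_state sigma -> pauli_anticomm p p' (+) pauli_anticomm q q' ->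
  (-1) ^+ b * pauli_coef sigma p q + (-1) ^+ b' * pauli_coef sigma p' q' <= 1.
Proof.
move=> sg anti; apply: le_trans (stab_state_anticomm _ _ _ _ _ sg anti).
by apply: lerD; [rewrite -(normrMsign b)|rewrite -(normrMsign b')]; apply: ler_norm.
Qed.

(** [codeop] is affine, not linear, in the Bloch vector, hence the weights summing to 1; they may be
    negative, as the extent allows. *)
Lemma codeop_sum3 (w1 w2 w3 z1 z2 z3 x1 x2 x3 y1 y2 y3 z x y : R) :
  w1 + w2 + w3 = 1 -> w1 * z1 + w2 * z2 + w3 * z3 = z ->
  w1 * x1 + w2 * x2 + w3 * x3 = x -> w1 * y1 + w2 * y2 + w3 * y3 = y ->
  codeop z x y = \sum_(p <- [:: (w1, codeop z1 x1 y1); (w2, codeop z2 x2 y2);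
    (w3, codeop z3 x3 y3)]) rC p.1 *: p.2.
Proof.
have sum3 (A B D : Mat) : \sum_(p <- [:: (w1, A); (w2, B); (w3, D)]) rC p.1 *: p.2 =
    rC w1 *: A + (rC w2 *: B + rC w3 *: D) by rewrite !big_cons big_nil addr0.
move=> w wz wx wy; rewrite sum3 /codeop !codemxZ !codemxD.
by apply: eq_codemx; apply: eq_complexP => /=; lra.
Qed.

Lemma W_free_codeop (w1 w2 z1 z2 x1 x2 y1 y2 : R) :
  0 <= w1 -> 0 <= w2 -> w1 + w2 = 1 ->
  stab_state (codeop z1 x1 y1) -> stab_state (codeop z2 x2 y2) ->
  W_free (wigner (codeop (w1 * z1 + w2 * z2) (w1 * x1 + w2 * x2) (w1 * y1 + w2 * y2))).
Proof.
move=> w10 w20 w12 st1 st2.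
have affine a :
    wigner (codeop (w1 * z1 + w2 * z2) (w1 * x1 + w2 * x2) (w1 * y1 + w2 * y2)) a =
    w1 * wigner (codeop z1 x1 y1) a + w2 * wigner (codeop z2 x2 y2) a.
  have -> : w2 = 1 - w1 by lra.
  by rewrite !wigner_codeop; cbn zeta; field.
move: (codeop z1 x1 y1) (codeop z2 x2 y2) st1 st2 affine => A B st1 st2 affine.
exists [:: (w1, A); (w2, B)]; split.
- by move=> x; rewrite !inE => /orP[] /eqP ->.
- by rewrite !big_cons big_nil addr0.
- by move=> a; rewrite !big_cons big_nil addr0 affine.
Qed.

(** The eight phase points with different Z signs contribute [|x - x'| / 8] each. *)
Lemma l1dist_codeop_x (z x x' y : R) :
  l1dist (wigner (codeop z x y)) (wigner (codeop z x' y)) = `|x - x'|.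
Proof.
have E a : `|wigner (codeop z x y) a - wigner (codeop z x' y) a| =
    `|x - x'| * ((1 - pauli_sgn PZ a.1 * pauli_sgn PZ a.2) / 16).
  have -> : (1 - pauli_sgn PZ a.1 * pauli_sgn PZ a.2) / 16 =
      `|pauli_sgn PX a.1 * pauli_sgn PX a.2
        * ((1 - pauli_sgn PZ a.1 * pauli_sgn PZ a.2) / 16)| :> R.
    rewrite !normrM !normr_sign !mul1r -normrM ger0_norm //.
    by case: a => [[[] p] [[] q]] /=; rewrite ?expr0 ?expr1; lra.
  by rewrite -normrM !wigner_codeop /=; congr `|_|; field.
rewrite /l1dist; under eq_bigr do rewrite E.
by rewrite -mulr_sumr big_bool4 !big_bool /= ?expr0 ?expr1; field.
Qed.

(** The changes in [z] and [y] cancel at half of the points with equal Z signs and reinforce at the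
    other four, each contributing [d / 4]. Moving both coordinates thus costs no more than moving
    one. *)
Lemma l1dist_codeop_zy (b : bool) (z x y d : R) : 0 <= d ->
  l1dist (wigner (codeop (z + (-1) ^+ b * d) x (y - d))) (wigner (codeop z x y)) = d.
Proof.
move=> d0.
have E a : `|wigner (codeop (z + (-1) ^+ b * d) x (y - d)) a - wigner (codeop z x y) a| =
    d * ((1 + pauli_sgn PZ a.1 * pauli_sgn PZ a.2)
         * (1 - (-1) ^+ b * (pauli_sgn PX a.1 * pauli_sgn PX a.2)) / 16).
  have -> : (1 + pauli_sgn PZ a.1 * pauli_sgn PZ a.2)
         * (1 - (-1) ^+ b * (pauli_sgn PX a.1 * pauli_sgn PX a.2)) / 16 =
      `|(pauli_sgn PZ a.1 + pauli_sgn PZ a.2)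
         * ((-1) ^+ b - pauli_sgn PX a.1 * pauli_sgn PX a.2) / 16| :> R.
    have n16 : `|16^-1| = 16^-1 :> R by rewrite ger0_norm // invr_ge0 ler0n.
    rewrite !normrM n16; congr (_ * _ * _).
      by case: a => [[[] p] [[] q]] /=; rewrite ?expr0 ?expr1;
        [rewrite ler0_norm|rewrite ger0_norm|rewrite ger0_norm|rewrite ger0_norm]; lra.
    case: a => [[p []] [q []]]; case: b => /=; rewrite ?expr0 ?expr1;
      by (rewrite ger0_norm; lra) || (rewrite ler0_norm; lra).
  by rewrite -[X in _ = X * _](ger0_norm d0) -normrM !wigner_codeop /=; congr `|_|; field.
rewrite /l1dist; under eq_bigr do rewrite E.
by rewrite -mulr_sumr big_bool4 !big_bool /= ?expr0 ?expr1; field.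
Qed.

(** * Distances and extents *)

Section UnitCircle.
Variables c s : R.
Hypotheses (s_ge0 : 0 <= s) (cs1 : c ^+ 2 + s ^+ 2 = 1).

(** The sign of [c], equal to 1 at [c = 0], so that [codeop e 0 0] is always a vertex of the
    octahedron. *)
Let e : R := (-1) ^+ (c < 0)%R.

Let eE : `|c| = e * c.
Proof. exact: normrEsign. Qed.

Let ec : e * `|c| = c.
Proof. by rewrite eE mulrA -expr2 sqrr_sign mul1r. Qed.

Let e_le1 : `|e| <= 1.
Proof. by rewrite normr_sign. Qed.

(** All three follow by comparing squares; the last because the square of [|c| + s] is
    [1 + 2 |c| s]. *)
Let l1_bounds : [/\ `|c| <= 1, s <= 1 & 1 <= `|c| + s].
Proof.
have h : `|c| ^+ 2 + s ^+ 2 = 1 by rewrite real_normK ?num_real.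
have c0 := normr_ge0 c; have c2 := sqr_ge0 `|c|; have s2 := sqr_ge0 s.
have cs := mulr_ge0 c0 s_ge0.
split; rewrite -(@ler_pXn2r _ 2) ?nnegrE ?addr_ge0 ?ler01 // expr1n; lra.
Qed.

Let sum3 (w1 w2 w3 : R) (A B D : Mat) :
  \sum_(p <- [:: (w1, A); (w2, B); (w3, D)]) `|p.1| = `|w1| + `|w2| + `|w3|.
Proof. by rewrite !big_cons big_nil addr0 addrA. Qed.

Lemma extent_codeop_x : stab_extent (codeop c s 0) = `|c| + s.
Proof.
have [c1 s1 cs] := l1_bounds; apply: inf_min; last first.
  move=> _ [l [lP lE ->]].
  have := stab_extent_ge e 1 PZ PI PX PX _ l e_le1 _ _ lP lE.
  by rewrite !pauli_coef_codeop /= normr1 eE mul1r; apply.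
(* Weight [|c|] on the Z vertex gives the coordinate [c]; the two X weights are then forced, with
   sum [1 - |c|] and difference [s]. The last one is nonpositive. *)
exists [:: (`|c|, codeop e 0 0); ((s + 1 - `|c|) / 2, codeop 0 ((-1) ^+ false) 0);
  (- ((s + `|c| - 1) / 2), codeop 0 ((-1) ^+ true) 0)]; split.
- move=> x; rewrite !inE => /or3P[] /eqP ->.
  + exact: stab_codeop_z.
  + exact: (stab_codeop_x false).
  + exact: (stab_codeop_x true).
- by apply: codeop_sum3; move: ec; rewrite ?expr0 ?expr1; move: e => t tc; lra.
- have w2 : 0 <= (s + 1 - `|c|) / 2 by lra.
  have w3 : 0 <= (s + `|c| - 1) / 2 by lra.
  by rewrite sum3 normr_id normrN (ger0_norm w2) (ger0_norm w3); lra.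
Qed.

Lemma extent_codeop_y : stab_extent (codeop c 0 (- s)) = `|c| + s.
Proof.
have [c1 s1 cs] := l1_bounds; apply: inf_min; last first.
  move=> _ [l [lP lE ->]].
  have := stab_extent_ge e (-1) PZ PI PX PY _ l e_le1 _ _ lP lE.
  by rewrite !pauli_coef_codeop /= normrN1 eE mulN1r opprK; apply.
(* The same weights, with the Y vertex at -1 carrying the positive one. *)
exists [:: (`|c|, codeop e 0 0); ((s + 1 - `|c|) / 2, codeop 0 0 ((-1) ^+ true));
  (- ((s + `|c| - 1) / 2), codeop 0 0 ((-1) ^+ false))]; split.
- move=> x; rewrite !inE => /or3P[] /eqP ->.
  + exact: stab_codeop_z.
  + exact: (stab_codeop_y true).
  + exact: (stab_codeop_y false).
- by apply: codeop_sum3; move: ec; rewrite ?expr0 ?expr1; move: e => t tc; lra.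
- have w2 : 0 <= (s + 1 - `|c|) / 2 by lra.
  have w3 : 0 <= (s + `|c| - 1) / 2 by lra.
  by rewrite sum3 normr_id normrN (ger0_norm w2) (ger0_norm w3); lra.
Qed.

Lemma distance_codeop_x : wigner_distance (codeop c s 0) = `|c| + s - 1.
Proof.
have [c1 s1 cs] := l1_bounds; apply: inf_min; last first.
  move=> _ [f [fW ->]].
  have := l1dist_ge (witness_Ry e) 1 (codeop c s 0) f
    (fun a => witness_Ry_le1 e a e_le1) _ fW.
  rewrite witness_RyE !pauli_coef_codeop /= eE.
  rewrite (_ : (e * (c + c) + s - - s) / 2 = e * c + s); last by field.
  apply=> sigma sg; rewrite witness_RyE.
  (* The witness is half the sum of two anticommuting pairs, [e ZI] with XX and [e IZ] with -YY,
     each contributing at most 1. *)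
  have := stab_state_anticomm_le sigma (c < 0)%R false PZ PI PX PX sg isT.
  have := stab_state_anticomm_le sigma (c < 0)%R true PI PZ PY PY sg isT.
  by rewrite -/e expr0 expr1; move: e (pauli_coef sigma) => t r; lra.
(* Keeping [z] and lowering [x] reaches the edge between the Z vertex [e] and the X vertex 1. *)
exists (wigner (codeop c (1 - `|c|) 0)); split.
  have := W_free_codeop `|c| (1 - `|c|) e 0 0 1 0 0 (normr_ge0 c) _ _
    (stab_codeop_z _) (stab_codeop_x false).
  rewrite !mulr0 !mulr1 !addr0 !add0r mulrC ec; apply; lra.
have d0 : 0 <= s - (1 - `|c|) by lra.
by rewrite l1dist_codeop_x (ger0_norm d0); lra.
Qed.

Lemma distance_codeop_y : wigner_distance (codeop c 0 (- s)) = 2^-1 * (`|c| + s - 1).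
Proof.
have [c1 s1 cs] := l1_bounds; apply: inf_min; last first.
  move=> _ [f [fW ->]].
  have := l1dist_ge (witness_Rx e) (2^-1) (codeop c 0 (- s)) f
    (fun a => witness_Rx_le1 e a e_le1) _ fW.
  rewrite witness_RxE !pauli_coef_codeop /= eE.
  rewrite (_ : (e * (c + c) - - s - - s) / 4 - 2^-1 = 2^-1 * (e * c + s - 1));
    last by field.
  apply=> sigma sg; rewrite witness_RxE.
  (* The pairs are [e ZI] with -XY and [e IZ] with -YX; division by 4 turns their total bound 2 into
     1/2. *)
  have := stab_state_anticomm_le sigma (c < 0)%R true PZ PI PX PY sg isT.
  have := stab_state_anticomm_le sigma (c < 0)%R true PI PZ PY PX sg isT.
  by rewrite -/e expr1; move: e (pauli_coef sigma) => t r; lra.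
(* Half the excess over the octahedron: shrinking both [|z|] and [|y|] by [d] reaches the edge
   between the Z vertex [e] and the Y vertex -1, at total cost [d]. *)
pose d := 2^-1 * (`|c| + s - 1).
exists (wigner (codeop (c - e * d) 0 (- s + d))); split.
  have := W_free_codeop ((1 + `|c| - s) / 2) ((1 + s - `|c|) / 2) e 0 0 0 0 (-1) _ _ _
    (stab_codeop_z _) (stab_codeop_y true).
  rewrite !mulr0 !addr0 !add0r.
  have -> : (1 + `|c| - s) / 2 * e = c - e * d.
    by rewrite /d; move: e ec => t tc; lra.
  have -> : (1 + s - `|c|) / 2 * -1 = - s + d by rewrite /d; lra.
  by apply; lra.
have d0 : 0 <= d by rewrite /d; lra.
have := l1dist_codeop_zy (c < 0)%R (c - e * d) 0 (- s + d) d d0.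
by rewrite -/e subrK addrK => ->.
Qed.

End UnitCircle.
End WignerExtent.

Theorem theorem5p1 (R : realType) (theta : R) :
  0 < theta < pi ->
  [/\ wigner_distance (rhoRy theta) = `|sin theta| + `|cos theta| - 1,
      wigner_distance (rhoRx theta) = 2^-1 * (`|sin theta| + `|cos theta| - 1),
      stab_extent (rhoRy theta) = `|sin theta| + `|cos theta|
    & stab_extent (rhoRx theta) = `|sin theta| + `|cos theta|] /\
  ((0 < wigner_distance (rhoRy theta) -> tightness (rhoRy theta) = 1) /\
   (0 < wigner_distance (rhoRx theta) -> tightness (rhoRx theta) = 2)).
Proof.
move=> theta_pi; have s0 := ltW (sin_gt0_pi theta_pi).
have cs1 := cos2Dsin2 theta.
have dy : wigner_distance (rhoRy theta) = `|sin theta| + `|cos theta| - 1.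
  by rewrite rhoRyE distance_codeop_x // (ger0_norm s0) (addrC (sin _)).
have dx : wigner_distance (rhoRx theta) = 2^-1 * (`|sin theta| + `|cos theta| - 1).
  by rewrite rhoRxE distance_codeop_y // (ger0_norm s0) (addrC (sin _)).
have ey : stab_extent (rhoRy theta) = `|sin theta| + `|cos theta|.
  by rewrite rhoRyE extent_codeop_x // (ger0_norm s0) addrC.
have ex : stab_extent (rhoRx theta) = `|sin theta| + `|cos theta|.
  by rewrite rhoRxE extent_codeop_y // (ger0_norm s0) addrC.
split=> //; split; rewrite /tightness ?dy ?ey ?dx ?ex => pos.
  by rewrite divff // gt_eqF.
have nz : `|sin theta| + `|cos theta| - 1 != 0.
  by apply: lt0r_neq0; move: pos; rewrite pmulr_rgt0 ?invr_gt0 ?ltr0n.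
by rewrite invfM invrK mulrCA mulfV // mulr1.
Qed.
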